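(* Let $(X,G)$ be a minimal system with finite minimal rank, and suppose that $G$ is compactly generated. Then $\Pr=\mathcal Q$ if and only if $\Pr$ is a closed subset of $X\times X$.
   Context: Let $X$ be a compact metric space with metric $d$ and $G$ a locally compact abelian group acting continuously and minimally on $X$, written $t\cdot x$. $G$ is compactly generated if there is a compact neighborhood $K$ of $0$ with $G=\bigcup_{n\in\mathbb N}nK$, $nK=K+\dots+K$. Proximal relation: $\Pr=\{(x,y):\inf_{t\in G}d(t\cdot x,t\cdot y)=0\}$. For $\epsilon>0$, $\Pr_\epsilon=\{(x,y):\inf_{t\in G}d(t\cdot x,t\cdot y)<\epsilon\}$, and the regional proximal relation is $\mathcal Q=\bigcap_{\epsilon>0}\overline{\Pr_\epsilon}$. Let $\pi_{max}:X\to X_{max}$ be the maximal equicontinuous factor; the minimal rank is $mr=\inf\{\#\pi_{max}^{-1}(x):x\in X_{max}\}$. *)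

(* Defs.v *)
From Stdlib Require Import Reals List.
Open Scope R_scope.

Definition is_topology {T : Type} (op : (T -> Prop) -> Prop) : Prop :=
  op (fun _ => True) /\ op (fun _ => False) /\
  (forall U V, op U -> op V -> op (fun x => U x /\ V x)) /\
  (forall F : (T -> Prop) -> Prop,
      (forall U, F U -> op U) -> op (fun x => exists U, F U /\ U x)).

Definition hausdorff {T : Type} (op : (T -> Prop) -> Prop) : Prop :=
  forall x y : T, x <> y ->
    exists U V, op U /\ op V /\ U x /\ V y /\ (forall z, ~ (U z /\ V z)).

Definition compact_in {T : Type} (op : (T -> Prop) -> Prop) (K : T -> Prop) : Prop :=
  forall (I : Type) (C : I -> T -> Prop),
    (forall i, op (C i)) -> (forall x, K x -> exists i, C i x) ->
    exists l : list I, forall x, K x -> exists i, In i l /\ C i x.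

Definition is_nbhd {T : Type} (op : (T -> Prop) -> Prop) (N : T -> Prop) (x : T) : Prop :=
  exists U, op U /\ U x /\ (forall y, U y -> N y).

Definition locally_compact {T : Type} (op : (T -> Prop) -> Prop) : Prop :=
  forall x : T, exists K, compact_in op K /\ is_nbhd op K x.

Definition is_abgroup {G : Type} (zero : G) (add : G -> G -> G) (opp : G -> G) : Prop :=
  (forall a b c, add a (add b c) = add (add a b) c) /\
  (forall a b, add a b = add b a) /\
  (forall a, add zero a = a) /\
  (forall a, add (opp a) a = zero).

Definition is_LCA_group {G : Type} (op : (G -> Prop) -> Prop)
  (zero : G) (add : G -> G -> G) (opp : G -> G) : Prop :=
  is_topology op /\ hausdorff op /\ is_abgroup zero add opp /\
  (forall W a b, op W -> W (add a b) ->
     exists U V, op U /\ op V /\ U a /\ V b /\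
       (forall u v, U u -> V v -> W (add u v))) /\
  (forall W, op W -> op (fun x => W (opp x))) /\
  locally_compact op.

Fixpoint multK {G : Type} (zero : G) (add : G -> G -> G) (n : nat) (K : G -> Prop)
  : G -> Prop :=
  match n with
  | O => fun g => g = zero
  | S m => fun g => exists a b, multK zero add m K a /\ K b /\ g = add a b
  end.

Definition compactly_generated {G : Type} (op : (G -> Prop) -> Prop)
  (zero : G) (add : G -> G -> G) : Prop :=
  exists K : G -> Prop, compact_in op K /\ is_nbhd op K zero /\
    (forall g, exists n, (1 <= n)%nat /\ multK zero add n K g).

Definition is_metric {X : Type} (d : X -> X -> R) : Prop :=
  forall x y z, 0 <= d x y /\ (d x y = 0 <-> x = y) /\ d x y = d y x /\
                d x z <= d x y + d y z.

Definition metric_open {X : Type} (d : X -> X -> R) (U : X -> Prop) : Prop :=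
  forall x, U x -> exists r, r > 0 /\ forall y, d x y < r -> U y.

Definition compact_metric {X : Type} (d : X -> X -> R) : Prop :=
  is_metric d /\ compact_in (metric_open d) (fun _ => True).

Definition is_action {G X : Type} (zero : G) (add : G -> G -> G) (act : G -> X -> X) : Prop :=
  (forall x, act zero x = x) /\
  (forall s t x, act (add s t) x = act s (act t x)).

Definition continuous_action {G X : Type} (opG : (G -> Prop) -> Prop)
  (d : X -> X -> R) (act : G -> X -> X) : Prop :=
  forall t x eps, eps > 0 ->
    exists U delta, opG U /\ U t /\ delta > 0 /\
      (forall s y, U s -> d x y < delta -> d (act t x) (act s y) < eps).

Definition is_system {G X : Type} (opG : (G -> Prop) -> Prop) (zero : G)
  (add : G -> G -> G) (d : X -> X -> R) (act : G -> X -> X) : Prop :=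
  compact_metric d /\ is_action zero add act /\ continuous_action opG d act.

Definition minimal_system {G X : Type} (d : X -> X -> R) (act : G -> X -> X) : Prop :=
  forall x y eps, eps > 0 -> exists t, d (act t x) y < eps.

Definition equicontinuous {G X : Type} (d : X -> X -> R) (act : G -> X -> X) : Prop :=
  forall eps, eps > 0 -> exists delta, delta > 0 /\
    forall y y', d y y' < delta -> forall t, d (act t y) (act t y') < eps.

Definition cont_map {X Y : Type} (dX : X -> X -> R) (dY : Y -> Y -> R) (f : X -> Y) : Prop :=
  forall x eps, eps > 0 -> exists delta, delta > 0 /\
    forall x', dX x x' < delta -> dY (f x) (f x') < eps.

Definition is_factor_map {G X Y : Type} (dX : X -> X -> R) (actX : G -> X -> X)
  (dY : Y -> Y -> R) (actY : G -> Y -> Y) (pi : X -> Y) : Prop :=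
  cont_map dX dY pi /\ (forall y, exists x, pi x = y) /\
  (forall t x, pi (actX t x) = actY t (pi x)).

Definition is_max_eq_factor {G X Y : Type} (opG : (G -> Prop) -> Prop) (zero : G)
  (add : G -> G -> G) (dX : X -> X -> R) (actX : G -> X -> X)
  (dY : Y -> Y -> R) (actY : G -> Y -> Y) (pi : X -> Y) : Prop :=
  is_system opG zero add dY actY /\ equicontinuous dY actY /\
  is_factor_map dX actX dY actY pi /\
  (forall (Z : Type) (dZ : Z -> Z -> R) (actZ : G -> Z -> Z) (rho : X -> Z),
     is_system opG zero add dZ actZ -> equicontinuous dZ actZ ->
     is_factor_map dX actX dZ actZ rho ->
     exists phi : Y -> Z, cont_map dY dZ phi /\ forall x, rho x = phi (pi x)).

(* minimal rank is finite: some fibre of pi_max is a finite set *)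
Definition finite_minimal_rank {X Y : Type} (pi : X -> Y) : Prop :=
  exists y : Y, exists l : list X, forall x, pi x = y -> In x l.

Definition Prox {G X : Type} (d : X -> X -> R) (act : G -> X -> X) (x y : X) : Prop :=
  forall eps, eps > 0 -> exists t, d (act t x) (act t y) < eps.

Definition Prox_eps {G X : Type} (d : X -> X -> R) (act : G -> X -> X) (eps : R)
  (x y : X) : Prop :=
  exists t, d (act t x) (act t y) < eps.

Definition closure2 {X : Type} (d : X -> X -> R) (A : X -> X -> Prop) (x y : X) : Prop :=
  forall delta, delta > 0 -> exists x' y', A x' y' /\ d x x' < delta /\ d y y' < delta.

Definition closed2 {X : Type} (d : X -> X -> R) (A : X -> X -> Prop) : Prop :=
  forall x y, closure2 d A x y -> A x y.

Definition RegProx {G X : Type} (d : X -> X -> R) (act : G -> X -> X) (x y : X) : Prop :=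
  forall eps, eps > 0 -> closure2 d (Prox_eps d act eps) x y.

(* Main.v *)
(** One inclusion of [Pr = Q] is free, and [Q] is contained in the kernel
    relation [R] of the map to the maximal equicontinuous factor.  Assume [Pr]
    closed, hence an equivalence relation.  Finiteness of one fibre forces every
    fibre of [pimax] to carry the same finite number of proximality classes, which
    makes [R \ Pr] closed.  So [Pr] and [R \ Pr] are disjoint compact sets: a pair
    whose images are close is either near [Pr] or near [R \ Pr], and acting by the
    compact generating set cannot move it from the first kind to the second.  By
    compact generation a pair near [Pr] whose images stay close stays near [Pr]
    forever, so [X/Pr] is equicontinuous.  By maximality it is a factor of [Xmax],
    that is, [R] is contained in [Pr].

    Limits are taken along a free ultrafilter on [nat]; this also handles
    sequences in the group, whose topology need not be metrizable. *)
Require Import Defs.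
From Stdlib Require Import Reals List Lra Lia.
From Stdlib Require Import Classical ClassicalEpsilon.
From Stdlib Require Import FunctionalExtensionality PropExtensionality ProofIrrelevance.
From mathcomp Require filter.
Open Scope R_scope.

(** * Limits along a free ultrafilter *)

Record free_ultrafilter (U : (nat -> Prop) -> Prop) : Prop := {
  fu_mono : forall P Q : nat -> Prop, U P -> (forall k, P k -> Q k) -> U Q;
  fu_and : forall P Q : nat -> Prop, U P -> U Q -> U (fun k => P k /\ Q k);
  fu_em : forall P : nat -> Prop, U P \/ U (fun k => ~ P k);
  fu_false : ~ U (fun _ => False);
  fu_ge : forall N, U (fun k => (N <= k)%nat) }.

(** An ultrafilter refining the filter of cofinal tails contains every tail, hence is free. *)
Lemma free_ultrafilter_exists : exists U, free_ultrafilter U.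
Proof.
destruct (@filter.ultraFilterLemma nat filter.eventually filter.eventually_filter)
  as [U [HU sub]].
assert (HP := @filter.ultra_proper _ _ HU).
assert (HF := @filter.filter_filter _ _ HP).
exists U; constructor.
- intros P Q HPU HPQ; exact (@filter.filterS _ _ HF P Q HPQ HPU).
- intros P Q; exact (@filter.filterI _ _ HF P Q).
- intros P; exact (@filter.in_ultra_setVsetC _ U P HU).
- exact (@filter.filter_not_empty _ _ HP).
- intros N; apply sub; exists N; [exact I|].
  intros k Hk; exact (ssrbool.elimT ssrnat.leP Hk).
Qed.

Section Ultralimits.

Variables (U : (nat -> Prop) -> Prop) (HU : free_ultrafilter U).

Lemma fu_true (P : nat -> Prop) : (forall k, P k) -> U P.
Proof. intros H; apply (fu_mono _ HU _ _ (fu_ge _ HU 0)); auto. Qed.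

Lemma fu_mono2 (P Q S : nat -> Prop) :
  U P -> U Q -> (forall k, P k -> Q k -> S k) -> U S.
Proof.
intros HP HQ H; apply (fu_mono _ HU _ _ (fu_and _ HU _ _ HP HQ)).
intros k [? ?]; auto.
Qed.

Lemma fu_ex (P : nat -> Prop) : U P -> exists k, P k.
Proof.
intros HP; apply NNPP; intros N; apply (fu_false _ HU), (fu_mono _ HU _ _ HP).
intros k Pk; apply N; eauto.
Qed.

Lemma fu_list (A : Type) (l : list A) (P : A -> nat -> Prop) :
  (forall x, In x l -> U (P x)) -> U (fun k => forall x, In x l -> P x k).
Proof.
induction l as [|a l IH]; intros H.
- apply fu_true; intros k x [].
- apply (fu_mono2 _ _ _ (H a (or_introl eq_refl))
                  (IH (fun x Hx => H x (or_intror Hx)))).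
  intros k Ha Hl x [<-|Hx]; auto.
Qed.

(** The pigeonhole principle: a choice among finitely many points that varies with [k] becomes
    constant on a [U]-large set. *)
Lemma fu_list_ex (A : Type) (l : list A) (P : A -> nat -> Prop) :
  U (fun k => exists x, In x l /\ P x k) -> exists x, In x l /\ U (P x).
Proof.
intros H; apply NNPP; intros N.
assert (H' : U (fun k => forall x, In x l -> ~ P x k)).
{ apply fu_list; intros x Hx; destruct (fu_em _ HU (P x)); auto.
  exfalso; eauto. }
destruct (fu_ex _ (fu_and _ HU _ _ H H')) as [k [[x [Hx Px]] Hk]].
exact (Hk x Hx Px).
Qed.

Lemma fu_inv (eps : R) : eps > 0 -> U (fun k => / INR (S k) < eps).
Proof.
intros He; destruct (archimed_cor1 eps He) as [N [HN N0]].
apply (fu_mono _ HU _ _ (fu_ge _ HU N)); intros k Hk.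
apply Rle_lt_trans with (2 := HN), Rinv_le_contravar.
- apply lt_0_INR; lia.
- apply le_INR; lia.
Qed.

Lemma inv_S_pos (k : nat) : / INR (S k) > 0.
Proof. apply Rinv_0_lt_compat, lt_0_INR; lia. Qed.

(** Without a limit, every point has an open neighbourhood that [U]-almost all terms avoid. Finitely
    many of these cover [K], so some [u k] avoids them all, although it lies in [K]. *)
Lemma compact_in_ultralimit (T : Type) (op : (T -> Prop) -> Prop)
    (K : T -> Prop) (u : nat -> T) :
  compact_in op K -> (forall k, K (u k)) ->
  exists x, forall W, op W -> W x -> U (fun k => W (u k)).
Proof.
intros HK Hu; apply NNPP; intros N.
destruct (HK {W : T -> Prop | op W /\ U (fun k => ~ W (u k))}
             (fun W => proj1_sig W)) as [l Hl].
- intros [W HW]; exact (proj1 HW).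
- intros x _; apply NNPP; intros N'; apply N; exists x; intros W oW Wx.
  destruct (fu_em _ HU (fun k => W (u k))) as [|HW]; auto.
  exfalso; apply N'; now exists (exist _ W (conj oW HW)).
- assert (H : U (fun k => forall i, In i l -> ~ proj1_sig i (u k))).
  { apply fu_list; intros [W HW] _; exact (proj2 HW). }
  destruct (fu_ex _ H) as [k Hk].
  destruct (Hl (u k) (Hu k)) as [i [Hi Hik]]; exact (Hk i Hi Hik).
Qed.

Definition ulim {T : Type} (d : T -> T -> R) (u : nat -> T) (x : T) : Prop :=
  forall eps, eps > 0 -> U (fun k => d (u k) x < eps).

Section Metric.

Variables (T : Type) (d : T -> T -> R) (Hd : is_metric d).

Lemma dist_ge0 x y : 0 <= d x y.
Proof. apply (Hd x y x). Qed.

Lemma dist_eq0 x y : d x y = 0 -> x = y.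
Proof. apply (Hd x y x). Qed.

Lemma dist_xx x : d x x = 0.
Proof. now apply (Hd x x x). Qed.

Lemma dist_sym x y : d x y = d y x.
Proof. apply (Hd x y x). Qed.

Lemma dist_tri x y z : d x z <= d x y + d y z.
Proof. apply (Hd x y z). Qed.

Lemma dist_small_eq x y : (forall eps, eps > 0 -> d x y < eps) -> x = y.
Proof.
intros H; apply dist_eq0; destruct (Req_dec (d x y) 0) as [|N]; auto.
assert (d x y > 0) as P by (pose proof (dist_ge0 x y); lra).
specialize (H _ P); lra.
Qed.

Lemma metric_open_ball x r : metric_open d (fun y => d y x < r).
Proof.
intros y Hy; exists (r - d y x); split; [lra|].
intros z Hz; pose proof (dist_tri z y x); rewrite (dist_sym z y) in *; lra.
Qed.

Lemma ulim_exists (u : nat -> T) :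
  compact_in (metric_open d) (fun _ => True) -> exists x, ulim d u x.
Proof.
intros HK; destruct (compact_in_ultralimit _ _ _ u HK (fun _ => I)) as [x Hx].
exists x; intros eps He; apply (Hx _ (metric_open_ball x eps)).
rewrite dist_xx; lra.
Qed.

Lemma ulim_near (u v : nat -> T) x :
  ulim d u x -> (forall eps, eps > 0 -> U (fun k => d (u k) (v k) < eps)) ->
  ulim d v x.
Proof.
intros Hu Huv eps He.
apply (fu_mono2 _ _ _ (Hu (eps / 2) ltac:(lra)) (Huv (eps / 2) ltac:(lra))).
intros k; pose proof (dist_tri (v k) (u k) x); rewrite (dist_sym (v k) (u k)) in *; lra.
Qed.

Lemma ulim_inv (u v : nat -> T) x :
  ulim d u x -> (forall k, d (u k) (v k) < / INR (S k)) -> ulim d v x.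
Proof.
intros Hu H; apply ulim_near with (1 := Hu); intros eps He.
apply (fu_mono _ HU _ _ (fu_inv eps He)); intros k Hk.
eapply Rlt_trans; [apply H|exact Hk].
Qed.

Lemma ulim_cst x : ulim d (fun _ => x) x.
Proof. intros eps He; apply fu_true; rewrite dist_xx; auto. Qed.

Lemma ulim_to_inv (u : nat -> T) x :
  (forall k, d (u k) x < / INR (S k)) -> ulim d u x.
Proof.
intros H; apply ulim_inv with (1 := ulim_cst x).
intros k; rewrite dist_sym; apply H.
Qed.

Lemma ulim_dist_lt (u v : nat -> T) x y r :
  ulim d u x -> ulim d v y -> d x y < r -> U (fun k => d (u k) (v k) < r).
Proof.
intros Hu Hv H; set (e := (r - d x y) / 2).
apply (fu_mono2 _ _ _ (Hu e ltac:(unfold e; lra)) (Hv e ltac:(unfold e; lra))).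
unfold e; intros k H1 H2.
pose proof (dist_tri (u k) x (v k)); pose proof (dist_tri x y (v k)).
rewrite (dist_sym y (v k)) in *; lra.
Qed.

Lemma ulim_unique (u : nat -> T) x y : ulim d u x -> ulim d u y -> x = y.
Proof.
intros Hx Hy; apply dist_small_eq; intros eps He.
destruct (fu_ex _ (fu_and _ HU _ _ (Hx (eps / 2) ltac:(lra))
                          (Hy (eps / 2) ltac:(lra)))) as [k [H1 H2]].
pose proof (dist_tri x (u k) y); rewrite (dist_sym x (u k)) in *; lra.
Qed.

End Metric.

Lemma ulim_cont (S T : Type) (dS : S -> S -> R) (dT : T -> T -> R) (f : S -> T)
    (HS : is_metric dS) (HT : is_metric dT) (u : nat -> S) x :
  cont_map dS dT f -> ulim dS u x -> ulim dT (fun k => f (u k)) (f x).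
Proof.
intros Hf Hu eps He; destruct (Hf x eps He) as [dl [Hdl H]].
apply (fu_mono _ HU _ _ (Hu dl Hdl)); intros k Hk.
rewrite (dist_sym _ _ HT); apply H; now rewrite (dist_sym _ _ HS).
Qed.

End Ultralimits.

Lemma ulim_mono (U : (nat -> Prop) -> Prop) (HU : free_ultrafilter U)
    (T : Type) (d : T -> T -> R) (u v : nat -> T) x :
  ulim U d u x -> U (fun k => u k = v k) -> ulim U d v x.
Proof.
intros Hu H eps He; apply (fu_mono2 _ HU _ _ _ (Hu eps He) H).
intros k Hk Ek; now rewrite <- Ek.
Qed.

(** The [eps]-neighbourhood of [P] in the square of [X], for the maximum metric. *)
Definition near {X : Type} (d : X -> X -> R) (P : X -> X -> Prop) (eps : R)
    (a b : X) : Prop :=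
  exists p q, P p q /\ d a p < eps /\ d b q < eps.

(** * Proximal and regionally proximal pairs *)

Section Proximality.

Variables (U : (nat -> Prop) -> Prop) (HU : free_ultrafilter U).
Variables (G : Type) (opG : (G -> Prop) -> Prop)
  (zero : G) (add : G -> G -> G) (opp : G -> G).
Variables (X : Type) (d : X -> X -> R) (act : G -> X -> X).
Hypothesis HG : is_abgroup zero add opp.
Hypothesis Hsys : is_system opG zero add d act.

Notation prox := (Prox d act).
Notation "u ~> x" := (ulim U d u x) (at level 70).

Let Hd : is_metric d := proj1 (proj1 Hsys).

Lemma ulim_ex (u : nat -> X) : exists x, u ~> x.
Proof. apply ulim_exists; auto; apply Hsys. Qed.

Lemma ulim_act (s : nat -> G) t (u : nat -> X) x :
  (forall W, opG W -> W t -> U (fun k => W (s k))) -> u ~> x ->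
  (fun k => act (s k) (u k)) ~> act t x.
Proof.
intros Hs Hu eps He.
destruct (proj2 Hsys) as [_ Hc]; destruct (Hc t x eps He) as [W [dl [oW [Wt [Hdl H]]]]].
apply (fu_mono2 _ HU _ _ _ (Hs W oW Wt) (Hu dl Hdl)); intros k H1 H2.
rewrite (dist_sym _ _ Hd); apply H; auto; now rewrite (dist_sym _ _ Hd).
Qed.

Lemma ulim_act_cst t (u : nat -> X) x : u ~> x -> (fun k => act t (u k)) ~> act t x.
Proof. apply (ulim_act (fun _ => t)); intros; now apply (fu_true _ HU). Qed.

Lemma act_zero x : act zero x = x.
Proof. apply Hsys. Qed.

Lemma act_add s t x : act (add s t) x = act s (act t x).
Proof. apply Hsys. Qed.

Lemma act_oppK t x : act (opp t) (act t x) = x.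
Proof. rewrite <- act_add; rewrite (proj2 (proj2 (proj2 HG))); apply act_zero. Qed.

Lemma prox_refl x : prox x x.
Proof. intros eps He; exists zero; rewrite (dist_xx _ _ Hd); auto. Qed.

Lemma prox_sym x y : prox x y -> prox y x.
Proof. intros H eps He; destruct (H eps He) as [t Ht]; exists t.
now rewrite (dist_sym _ _ Hd). Qed.

Lemma prox_act t x y : prox x y -> prox (act t x) (act t y).
Proof.
intros H eps He; destruct (H eps He) as [s Hs]; exists (add s (opp t)).
now rewrite !act_add, !act_oppK.
Qed.

(** Proximality pulls back from limits of orbits: an [s] bringing [a] and [b] together also brings
    [act (t k) x] and [act (t k) y] together for some [k]. *)
Lemma prox_of_orbit_ulim (t : nat -> G) x y a b :
  (fun k => act (t k) x) ~> a -> (fun k => act (t k) y) ~> b ->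
  prox a b -> prox x y.
Proof.
intros Ha Hb Hab eps He; destruct (Hab eps He) as [s Hs].
destruct (fu_ex _ HU _ (ulim_dist_lt _ HU _ _ Hd _ _ _ _ _
  (ulim_act_cst s _ _ Ha) (ulim_act_cst s _ _ Hb) Hs)) as [k Hk].
exists (add s (t k)); now rewrite !act_add.
Qed.

Lemma regprox_closed : closed2 d (RegProx d act).
Proof.
intros x y H eps He dl Hdl.
destruct (H (dl / 2) ltac:(lra)) as [x1 [y1 [H1 [Hx1 Hy1]]]].
destruct (H1 eps He (dl / 2) ltac:(lra)) as [x2 [y2 [H2 [Hx2 Hy2]]]].
exists x2, y2; split; auto.
pose proof (dist_tri _ _ Hd x x1 x2); pose proof (dist_tri _ _ Hd y y1 y2); lra.
Qed.

Lemma prox_regprox x y : prox x y -> RegProx d act x y.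
Proof.
intros H eps He dl Hdl; exists x, y; rewrite !(dist_xx _ _ Hd).
repeat split; auto; now apply H.
Qed.

(** * Regional proximality over an equicontinuous factor *)

Section Factor.

Variables (Y : Type) (dY : Y -> Y -> R) (actY : G -> Y -> Y) (pi : X -> Y).
Hypothesis HY : is_system opG zero add dY actY.
Hypothesis Heq : equicontinuous dY actY.
Hypothesis Hpi : is_factor_map d act dY actY pi.

Let HdY : is_metric dY := proj1 (proj1 HY).

Lemma pi_act t x : pi (act t x) = actY t (pi x).
Proof. apply Hpi. Qed.

Lemma ulim_pi (u : nat -> X) x : u ~> x -> ulim U dY (fun k => pi (u k)) (pi x).
Proof. apply ulim_cont; auto; apply Hpi. Qed.

(** Approximate [(x, y)] by pairs with ever closer translates. The images of these translates share
    a limit, and equicontinuity carries their closeness back to the images of the original pairs. *)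
Lemma regprox_pi x y : RegProx d act x y -> pi x = pi y.
Proof.
intros H.
assert (H1 : forall k, exists p : X * X * G,
  d (act (snd p) (fst (fst p))) (act (snd p) (snd (fst p))) < / INR (S k) /\
  d x (fst (fst p)) < / INR (S k) /\ d y (snd (fst p)) < / INR (S k)).
{ intros k; destruct (H _ (inv_S_pos k) _ (inv_S_pos k)) as [a [b [[t Ht] Hab]]].
  now exists (a, b, t). }
apply choice in H1; destruct H1 as [p Hp].
set (u := fun k => fst (fst (p k))); set (v := fun k => snd (fst (p k))).
set (t := fun k => snd (p k)).
destruct (ulim_ex (fun k => act (t k) (u k))) as [a Ha].
assert (Hb : (fun k => act (t k) (v k)) ~> a).
{ apply (ulim_inv _ HU _ _ Hd) with (1 := Ha); intros k; apply Hp. }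
assert (Hu : u ~> x).
{ apply (ulim_inv _ HU _ _ Hd _ _ _ (ulim_cst _ HU _ _ Hd x)); intros k; apply Hp. }
assert (Hv : v ~> y).
{ apply (ulim_inv _ HU _ _ Hd _ _ _ (ulim_cst _ HU _ _ Hd y)); intros k; apply Hp. }
apply ulim_pi in Ha, Hb, Hu, Hv.
apply (ulim_unique _ HU _ _ HdY (fun k => pi (v k))); auto.
apply (ulim_near _ HU _ _ HdY) with (1 := Hu); intros eps He.
destruct (Heq eps He) as [dl [Hdl E]].
assert (H0 : dY (pi a) (pi a) < dl) by (rewrite (dist_xx _ _ HdY); auto).
apply (fu_mono _ HU _ _ (ulim_dist_lt _ HU _ _ HdY _ _ _ _ _ Ha Hb H0)).
(* The modulus is uniform in the group, so it applies to the inverse translation although [t k]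
   varies. *)
intros k Hk; specialize (E _ _ Hk (opp (t k))).
now rewrite <- !pi_act, !act_oppK in E.
Qed.

(** * Closed proximality relation *)

Hypothesis Hcl : closed2 d prox.

Lemma prox_ulim (u v : nat -> X) x y :
  u ~> x -> v ~> y -> U (fun k => prox (u k) (v k)) -> prox x y.
Proof.
intros Hu Hv H; apply Hcl; intros dl Hdl.
destruct (fu_ex _ HU _ (fu_and _ HU _ _ H (fu_and _ HU _ _ (Hu dl Hdl) (Hv dl Hdl))))
  as [k [H1 [H2 H3]]].
exists (u k), (v k); now rewrite (dist_sym _ _ Hd x), (dist_sym _ _ Hd y).
Qed.

(** Translations that merge [x] and [y] into [a] keep the translates of [y] and [z] proximal.
    Closedness makes the limits [a] and [c] proximal, and this pulls back to [x] and [z]. *)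
Lemma prox_trans x y z : prox x y -> prox y z -> prox x z.
Proof.
intros Hxy Hyz.
assert (H : forall k, exists t, d (act t x) (act t y) < / INR (S k)).
{ intros k; apply Hxy, inv_S_pos. }
apply choice in H; destruct H as [t Ht].
destruct (ulim_ex (fun k => act (t k) x)) as [a Ha].
destruct (ulim_ex (fun k => act (t k) z)) as [c Hc].
apply (prox_of_orbit_ulim t x z a c); auto.
assert (Ha' : (fun k => act (t k) y) ~> a)
  by now apply (ulim_inv _ HU _ _ Hd) with (1 := Ha).
apply (prox_ulim _ _ _ _ Ha' Hc), (fu_true _ HU); auto using prox_act.
Qed.

(** * Proximality classes in the fibres *)

Section FiniteFibre.

Variables (y0 : Y) (l : list X).
Hypothesis Hmin : minimal_system d act.
Hypothesis Hl : forall x, pi x = y0 -> In x l.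

(* On the finite fibre, [w] is a limit of translations, that is, the action of an
   element of the Ellis semigroup. *)
Definition limit_translation (w : X -> X) : Prop :=
  forall eps, eps > 0 -> exists t, forall x, pi x = y0 -> d (act t x) (w x) < eps.

Lemma limit_translation_seq w : limit_translation w ->
  exists t : nat -> G, forall x, pi x = y0 -> (fun k => act (t k) x) ~> w x.
Proof.
intros Hw.
assert (H : forall k, exists t, forall x, pi x = y0 -> d (act t x) (w x) < / INR (S k)).
{ intros k; apply Hw, inv_S_pos. }
apply choice in H; destruct H as [t Ht]; exists t; intros x Hx.
apply (ulim_to_inv _ HU _ _ Hd); auto.
Qed.

Lemma limit_translation_prox w x x' : limit_translation w ->
  pi x = y0 -> pi x' = y0 -> (prox (w x) (w x') <-> prox x x').
Proof.
intros Hw Hx Hx'; destruct (limit_translation_seq w Hw) as [t Ht]; split; intros H.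
- exact (prox_of_orbit_ulim t _ _ _ _ (Ht x Hx) (Ht x' Hx') H).
- apply (prox_ulim _ _ _ _ (Ht x Hx) (Ht x' Hx')), (fu_true _ HU); auto using prox_act.
Qed.

Lemma orbit_to x x' : exists t : nat -> G, (fun k => act (t k) x) ~> x'.
Proof.
assert (H : forall k, exists t, d (act t x) x' < / INR (S k)).
{ intros k; apply Hmin, inv_S_pos. }
apply choice in H; destruct H as [t Ht]; exists t.
now apply (ulim_to_inv _ HU _ _ Hd).
Qed.

Lemma orbit_ulim_pi (t : nat -> G) x x' a a' :
  pi x = pi x' -> (fun k => act (t k) x) ~> a -> (fun k => act (t k) x') ~> a' ->
  pi a = pi a'.
Proof.
intros E Ha Ha'; apply ulim_pi in Ha, Ha'.
apply (ulim_unique _ HU _ _ HdY (fun k => pi (act (t k) x))); auto.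
apply (ulim_mono _ HU _ _ _ _ _ Ha'), (fu_true _ HU); intros k.
now rewrite !pi_act, E.
Qed.

(** Minimality moves one point of the base fibre to a point over [y]; by equivariance the same limit
    moves the whole fibre there. *)
Lemma limit_translation_to y :
  exists w, limit_translation w /\ forall x, pi x = y0 -> pi (w x) = y.
Proof.
destruct (proj2 Hpi) as [Hs _].
destruct (Hs y0) as [x0 Hx0]; destruct (Hs y) as [x1 Hx1].
destruct (orbit_to x0 x1) as [t Ht].
destruct (choice _ (fun x => ulim_ex (fun k => act (t k) x))) as [w Hw].
exists w; split.
- intros eps He.
  (* Finiteness of the fibre lets a single [t k] serve all its points. *)
  assert (H : U (fun k => forall x, In x l -> d (act (t k) x) (w x) < eps)).
  { apply (fu_list _ HU); intros x _; now apply Hw. }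
  destruct (fu_ex _ HU _ H) as [k Hk]; exists (t k); auto.
- intros x Hx; rewrite <- Hx1; apply (orbit_ulim_pi t x x0); auto.
  now rewrite Hx.
Qed.

(* An injective self-map of a finite set is surjective: the orbit of [z] under
   [v] repeats, and the repetition is cancelled back to [z]. *)
Lemma fibre_self_map_surj (v : X -> X) z :
  (forall x, pi x = y0 -> pi (v x) = y0) ->
  (forall x x', pi x = y0 -> pi x' = y0 -> prox (v x) (v x') -> prox x x') ->
  pi z = y0 -> exists x, pi x = y0 /\ prox z (v x).
Proof.
intros Hv Hinj Hz.
assert (Hit : forall k x, pi x = y0 -> pi (Nat.iter k v x) = y0).
{ induction k; simpl; auto. }
assert (Hc : forall k x x', pi x = y0 -> pi x' = y0 ->
  prox (Nat.iter k v x) (Nat.iter k v x') -> prox x x').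
{ induction k; simpl; auto. }
destruct (fu_list_ex _ HU _ l (fun x k => Nat.iter k v z = x)) as [x [_ Hx]].
{ apply (fu_true _ HU); intros k; exists (Nat.iter k v z); auto. }
destruct (fu_ex _ HU _ Hx) as [i Hi].
destruct (fu_ex _ HU _ (fu_and _ HU _ _ Hx (fu_ge _ HU (S i)))) as [j [Hj Hij]].
(* The exponent [j - S i] leaves one application for the outer [v]. *)
exists (Nat.iter (j - S i) v z); split; auto.
apply (Hc i); auto.
rewrite Hi, <- Nat.iter_succ, <- Nat.iter_add.
replace (i + S (j - S i))%nat with j by lia.
rewrite Hj; apply prox_refl.
Qed.

(** Following [w] by a limit that takes [z] back to the base fibre gives a self-map [v] of that
    fibre, injective on proximality classes. It is therefore surjective on them, and the relation
    obtained pulls back to [z] and [w x]. *)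
Lemma limit_translation_surj w z :
  limit_translation w -> (forall x, pi x = y0 -> pi (w x) = pi z) ->
  exists x, pi x = y0 /\ prox z (w x).
Proof.
intros Hw Hz; destruct (proj2 Hpi) as [Hs _]; destruct (Hs y0) as [z0 Hz0].
destruct (orbit_to z z0) as [t Ht].
destruct (choice _ (fun x => ulim_ex (fun k => act (t k) (w x)))) as [v Hv].
destruct (fibre_self_map_surj v z0) as [x [Hx Hxz]]; auto.
- intros x Hx; rewrite <- Hz0; apply (orbit_ulim_pi t (w x) z); auto.
- intros x x' Hx Hx' H; apply (limit_translation_prox w); auto.
  exact (prox_of_orbit_ulim t _ _ _ _ (Hv x) (Hv x') H).
- exists x; split; auto; exact (prox_of_orbit_ulim t _ _ _ _ Ht (Hv x) Hxz).
Qed.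

Definition fibre_distal (a b : X) : Prop := pi a = pi b /\ ~ prox a b.

(** Parametrise the classes over [pi (u k)] by the base fibre through [W k]. By finiteness [u k] and
    [v k] have representatives [x], [x'] fixed for [U]-most [k]. If [a] and [b] were proximal, so
    would be [w x] and [w x'], then [x] and [x'], and finally [u k] and [v k]. *)
Lemma fibre_distal_ulim (u v : nat -> X) a b :
  u ~> a -> v ~> b -> (forall k, fibre_distal (u k) (v k)) -> fibre_distal a b.
Proof.
intros Hu Hv H; split.
{ apply (ulim_unique _ HU _ _ HdY (fun k => pi (u k))); [now apply ulim_pi|].
  apply (ulim_mono _ HU _ _ (fun k => pi (v k))); [now apply ulim_pi|].
  apply (fu_true _ HU); intros k; symmetry; apply H. }
intros Hab.
destruct (choice _ (fun k => limit_translation_to (pi (u k)))) as [W HW].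
destruct (choice _ (fun x => ulim_ex (fun k => W k x))) as [w Hw].
(* A limit of limit translations is one again: half of [eps] goes to each of the two
   approximations. *)
assert (Elim : limit_translation w).
{ intros eps He.
  assert (H1 : U (fun k => forall x, In x l -> d (W k x) (w x) < eps / 2)).
  { apply (fu_list _ HU); intros x _; apply Hw; lra. }
  destruct (fu_ex _ HU _ H1) as [k Hk].
  destruct (proj1 (HW k) (eps / 2) ltac:(lra)) as [t Ht]; exists t; intros x Hx.
  specialize (Hk x (Hl x Hx)); specialize (Ht x Hx).
  pose proof (dist_tri _ _ Hd (act t x) (W k x) (w x)); lra. }
assert (rep : forall z : nat -> X, (forall k, pi (z k) = pi (u k)) ->
  exists x, pi x = y0 /\ U (fun k => prox (z k) (W k x))).
{ intros z Hz.
  destruct (fu_list_ex _ HU _ l (fun x k => pi x = y0 /\ prox (z k) (W k x)))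
    as [x [_ Hx]].
  { apply (fu_true _ HU); intros k.
    destruct (limit_translation_surj (W k) (z k)) as [x [Hx Hxz]].
    - apply HW.
    - rewrite Hz; apply HW.
    - exists x; auto. }
  exists x; split; [now destruct (fu_ex _ HU _ Hx) as [k [? _]]|].
  apply (fu_mono _ HU _ _ Hx); tauto. }
destruct (rep u) as [x [Hx Hux]]; auto.
destruct (rep v) as [x' [Hx' Hvx]]; [intros k; symmetry; apply H|].
assert (Hxx' : prox x x').
{ apply (limit_translation_prox w); auto.
  apply prox_trans with a; [apply prox_sym; exact (prox_ulim _ _ _ _ Hu (Hw x) Hux)|].
  apply prox_trans with b; auto.
  exact (prox_ulim _ _ _ _ Hv (Hw x') Hvx). }
destruct (fu_ex _ HU _ (fu_and _ HU _ _ Hux Hvx)) as [k [H1 H2]].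
apply (proj2 (H k)), prox_trans with (1 := H1), prox_trans with (W k x').
- apply limit_translation_prox; auto; apply HW.
- now apply prox_sym.
Qed.

(** * Uniform separation of proximal and fibre-distal pairs *)

Lemma near_ulim (P : X -> X -> Prop) (u v : nat -> X) a b :
  (forall k, near d P (/ INR (S k)) (u k) (v k)) -> u ~> a -> v ~> b ->
  exists u' v', u' ~> a /\ v' ~> b /\ forall k, P (u' k) (v' k).
Proof.
intros H Hu Hv.
assert (H1 : forall k, exists p : X * X, P (fst p) (snd p) /\
  d (u k) (fst p) < / INR (S k) /\ d (v k) (snd p) < / INR (S k)).
{ intros k; destruct (H k) as [p [q Hpq]]; now exists (p, q). }
apply choice in H1; destruct H1 as [p Hp].
exists (fun k => fst (p k)), (fun k => snd (p k)); repeat split.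
- apply (ulim_inv _ HU _ _ Hd _ _ _ Hu); intros k; apply Hp.
- apply (ulim_inv _ HU _ _ Hd _ _ _ Hv); intros k; apply Hp.
- intros k; apply Hp.
Qed.

(** Counterexamples with vanishing tolerance would converge, the group elements by compactness of
    [K], to a pair both proximal and fibre-distal. The middle point [b] serves the triangle
    inequality later; [b = c] gives invariance under [K]. *)
Lemma near_prox_gap (K : G -> Prop) : compact_in opG K ->
  exists eps, eps > 0 /\ forall a b c s,
    near d prox eps a b -> near d prox eps b c -> K s ->
    ~ near d fibre_distal eps (act s a) (act s c).
Proof.
intros HK; apply NNPP; intros N.
assert (H : forall k, exists p : X * X * X * G,
  let '(a, b, c, s) := p in let e := / INR (S k) in
  near d prox e a b /\ near d prox e b c /\ K s /\
  near d fibre_distal e (act s a) (act s c)).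
{ intros k; apply NNPP; intros N'; apply N; exists (/ INR (S k)).
  split; [apply inv_S_pos|]; intros a b c s H1 H2 H3 H4; apply N'.
  now exists (a, b, c, s). }
apply choice in H; destruct H as [p Hp].
set (a := fun k => fst (fst (fst (p k)))); set (b := fun k => snd (fst (fst (p k)))).
set (c := fun k => snd (fst (p k))); set (s := fun k => snd (p k)).
assert (Hp' : forall k, near d prox (/ INR (S k)) (a k) (b k) /\
  near d prox (/ INR (S k)) (b k) (c k) /\ K (s k) /\
  near d fibre_distal (/ INR (S k)) (act (s k) (a k)) (act (s k) (c k))).
{ intros k; specialize (Hp k); unfold a, b, c, s.
  now destruct (p k) as [[[? ?] ?] ?]. }
destruct (ulim_ex a) as [a' Ha], (ulim_ex b) as [b' Hb], (ulim_ex c) as [c' Hc].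
destruct (compact_in_ultralimit _ HU _ _ _ s HK) as [s' Hs]; [intros k; apply Hp'|].
assert (prox_lim : forall u v x y,
  (forall k, near d prox (/ INR (S k)) (u k) (v k)) -> u ~> x -> v ~> y -> prox x y).
{ intros u v x y H Hu Hv; destruct (near_ulim _ _ _ _ _ H Hu Hv) as [u' [v' [? [? ?]]]].
  apply (prox_ulim u' v'); auto; now apply (fu_true _ HU). }
destruct (near_ulim fibre_distal _ _ _ _ (fun k => proj2 (proj2 (proj2 (Hp' k))))
  (ulim_act _ _ _ _ Hs Ha) (ulim_act _ _ _ _ Hs Hc)) as [u [v [Hu [Hv Huv]]]].
apply (fibre_distal_ulim _ _ _ _ Hu Hv Huv), prox_act, prox_trans with b'.
- apply (prox_lim a b); auto; intros k; apply Hp'.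
- apply (prox_lim b c); auto; intros k; apply Hp'.
Qed.

(** A limit of counterexamples would have equal images, so it would itself be proximal or
    fibre-distal and its approximants near it. *)
Lemma near_dichotomy eps : eps > 0 ->
  exists dl, dl > 0 /\ forall a b, dY (pi a) (pi b) < dl ->
    near d prox eps a b \/ near d fibre_distal eps a b.
Proof.
intros He; apply NNPP; intros N.
assert (H : forall k, exists p : X * X,
  dY (pi (fst p)) (pi (snd p)) < / INR (S k) /\
  ~ (near d prox eps (fst p) (snd p) \/ near d fibre_distal eps (fst p) (snd p))).
{ intros k; apply NNPP; intros N'; apply N; exists (/ INR (S k)).
  split; [apply inv_S_pos|]; intros a b H1; apply NNPP; intros H2; apply N'.
  now exists (a, b). }
apply choice in H; destruct H as [p Hp].
destruct (ulim_ex (fun k => fst (p k))) as [a Ha].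
destruct (ulim_ex (fun k => snd (p k))) as [b Hb].
assert (E : pi a = pi b).
{ apply (ulim_unique _ HU _ _ HdY (fun k => pi (snd (p k)))); [|now apply ulim_pi].
  apply (ulim_inv _ HU _ _ HdY (fun k => pi (fst (p k)))); [now apply ulim_pi|].
  intros k; apply Hp. }
destruct (fu_ex _ HU _ (fu_and _ HU _ _ (Ha eps He) (Hb eps He))) as [k [H1 H2]].
apply (proj2 (Hp k)); destruct (classic (prox a b)) as [P|P].
- left; now exists a, b.
- right; exists a, b; repeat split; auto.
Qed.

End FiniteFibre.

(** * The equicontinuous quotient by proximality *)

Section Quotient.

Variables (K : G -> Prop) (eps delta : R).
Hypothesis Hgen : forall g, exists n, (1 <= n)%nat /\ multK zero add n K g.
Hypothesis HK0 : K zero.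
Hypothesis eps0 : eps > 0.
Hypothesis delta0 : delta > 0.
Hypothesis gap : forall a b c s,
  near d prox eps a b -> near d prox eps b c -> K s ->
  ~ near d fibre_distal eps (act s a) (act s c).
Hypothesis dichotomy : forall a b, dY (pi a) (pi b) < delta ->
  near d prox eps a b \/ near d fibre_distal eps a b.

Notation close := (near d prox eps).

Lemma prox_close a b : prox a b -> close a b.
Proof. intros H; exists a, b; now rewrite !(dist_xx _ _ Hd). Qed.

Lemma close_sym a b : close a b -> close b a.
Proof. intros [p [q [H ?]]]; exists q, p; split; [now apply prox_sym|tauto]. Qed.

Lemma close_trans a b c :
  close a b -> close b c -> dY (pi a) (pi c) < delta -> close a c.
Proof.
intros Hab Hbc Hac; destruct (dichotomy _ _ Hac) as [|H]; auto.
destruct (gap a b c zero Hab Hbc HK0); now rewrite !act_zero.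
Qed.

(** Induction on the number of generators: the images stay [delta]-close, so the dichotomy applies
    at each step, and [gap] forbids one generator from leading to a nearly distal pair. *)
Lemma close_act a b : close a b ->
  (forall t, dY (actY t (pi a)) (actY t (pi b)) < delta) ->
  forall t, close (act t a) (act t b).
Proof.
intros Hab Ht t; destruct (Hgen t) as [n [_ Hn]]; revert t Hn.
induction n as [|n IH]; simpl; intros t Hn.
- now rewrite Hn, !act_zero.
- destruct Hn as [r [s [Hr [Hs ->]]]].
  (* [multK] writes the new generator on the right, but it must act last. *)
  assert (E : add r s = add s r) by apply HG; rewrite E, !act_add.
  destruct (dichotomy (act s (act r a)) (act s (act r b))) as [|H]; auto.
  { rewrite <- !act_add, !pi_act; apply Ht. }
  destruct (gap (act r a) (act r b) (act r b) s); auto.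
  apply prox_close, prox_refl.
Qed.

(** The pseudometric of the quotient by proximality. Truncation at [delta] confines the triangle
    inequality to the range where the dichotomy applies. *)
Definition quo_dist (a b : X) : R :=
  if excluded_middle_informative (close a b)
  then Rmin (dY (pi a) (pi b)) delta else delta.

Lemma quo_dist_lt a b r : r <= delta ->
  (quo_dist a b < r <-> close a b /\ dY (pi a) (pi b) < r).
Proof.
intros Hr; unfold quo_dist.
destruct (excluded_middle_informative (close a b)) as [H|H].
- unfold Rmin; destruct (Rle_dec (dY (pi a) (pi b)) delta); intuition lra.
- split; [lra|tauto].
Qed.

Lemma quo_dist_le a b : quo_dist a b <= delta.
Proof.
unfold quo_dist; destruct (excluded_middle_informative _); [apply Rmin_r|lra].
Qed.

Lemma quo_dist_ge0 a b : 0 <= quo_dist a b.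
Proof.
apply Rnot_lt_le; intros H; apply quo_dist_lt in H; [|lra].
pose proof (dist_ge0 _ _ HdY (pi a) (pi b)); lra.
Qed.

Lemma quo_dist_sym a b : quo_dist a b = quo_dist b a.
Proof.
assert (H : forall a b, quo_dist a b <= quo_dist b a).
{ intros x y; apply Rnot_lt_le; intros H.
  apply quo_dist_lt in H; [|apply quo_dist_le]; destruct H as [H1 H2].
  apply (Rlt_irrefl (quo_dist x y)), quo_dist_lt; [apply quo_dist_le|].
  split; [now apply close_sym|now rewrite (dist_sym _ _ HdY)]. }
apply Rle_antisym; apply H.
Qed.

Lemma quo_dist_tri a b c : quo_dist a c <= quo_dist a b + quo_dist b c.
Proof.
apply Rnot_lt_le; intros H.
pose proof (quo_dist_le a c); pose proof (quo_dist_ge0 a b);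
  pose proof (quo_dist_ge0 b c).
(* Half of the defect goes to each side, so the two strict bounds add up to [quo_dist a c]. *)
set (e := (quo_dist a c - quo_dist a b - quo_dist b c) / 2).
destruct (proj1 (quo_dist_lt a b (quo_dist a b + e) ltac:(unfold e; lra))
  ltac:(unfold e; lra)) as [H3 H4].
destruct (proj1 (quo_dist_lt b c (quo_dist b c + e) ltac:(unfold e; lra))
  ltac:(unfold e; lra)) as [H5 H6].
pose proof (dist_tri _ _ HdY (pi a) (pi b) (pi c)).
apply (Rlt_irrefl (quo_dist a c)), quo_dist_lt; auto.
assert (dY (pi a) (pi c) < quo_dist a c) by (unfold e in *; lra).
split; auto; apply (close_trans a b c); auto; lra.
Qed.

(** Distance zero means close with equal images; a non-proximal such pair would be fibre-distal,
    against [gap] at [zero]. *)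
Lemma quo_dist_eq0 a b : quo_dist a b = 0 <-> prox a b.
Proof.
split; intros H.
- assert (H1 : forall r, r > 0 -> close a b /\ dY (pi a) (pi b) < Rmin r delta).
  { intros r Hr; apply quo_dist_lt; [apply Rmin_r|].
    rewrite H; now apply Rmin_glb_lt. }
  apply NNPP; intros N.
  destruct (gap a b b zero); auto.
  + now apply (H1 1 Rlt_0_1).
  + apply prox_close, prox_refl.
  + exists a, b; rewrite !act_zero, !(dist_xx _ _ Hd); repeat split; auto.
    apply (dist_small_eq _ _ HdY); intros r Hr.
    apply Rlt_le_trans with (1 := proj2 (H1 r Hr)), Rmin_l.
- apply Rle_antisym; [|apply quo_dist_ge0].
  apply Rnot_lt_le; intros N; apply (Rlt_irrefl (quo_dist a b)), quo_dist_lt.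
  + apply quo_dist_le.
  + split; [now apply prox_close|].
    now rewrite (regprox_pi _ _ (prox_regprox _ _ H)), (dist_xx _ _ HdY).
Qed.

Lemma quo_dist_prox a a' b b' :
  prox a a' -> prox b b' -> quo_dist a b = quo_dist a' b'.
Proof.
assert (H : forall a a' b b', prox a a' -> prox b b' -> quo_dist a b <= quo_dist a' b').
{ intros x x' y y' Hx Hy.
  apply quo_dist_eq0 in Hx, Hy; rewrite (quo_dist_sym y) in Hy.
  pose proof (quo_dist_tri x x' y); pose proof (quo_dist_tri x' y' y); lra. }
intros Ha Hb; apply Rle_antisym; apply H; auto using prox_sym.
Qed.

Lemma quo_dist_cont x r : r > 0 ->
  exists e, e > 0 /\ forall x', d x x' < e -> quo_dist x x' < r.
Proof.
intros Hr; assert (Hc := proj1 Hpi).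
assert (Hm : Rmin r delta > 0) by now apply Rmin_glb_lt.
destruct (Hc x _ Hm) as [e [He H]].
exists (Rmin e eps); split; [now apply Rmin_glb_lt|]; intros x' Hx'.
pose proof (Rmin_l e eps); pose proof (Rmin_r e eps).
apply Rlt_le_trans with (2 := Rmin_l r delta), quo_dist_lt; [apply Rmin_r|].
split; [|apply H; lra].
(* The diagonal pair at [x] witnesses closeness of [x] and [x']. *)
exists x, x; rewrite (dist_xx _ _ Hd), (dist_sym _ _ Hd x'); repeat split;
  auto using prox_refl; lra.
Qed.

(** Equicontinuity downstairs, with modulus for [Rmin r delta], keeps the images within [delta]
    along the whole orbit, as [close_act] requires. *)
Lemma quo_dist_equicont r : r > 0 ->
  exists e, e > 0 /\
    forall a b, quo_dist a b < e -> forall t, quo_dist (act t a) (act t b) < r.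
Proof.
intros Hr; assert (Hm : Rmin r delta > 0) by now apply Rmin_glb_lt.
destruct (Heq _ Hm) as [e [He H]]; exists (Rmin e delta).
split; [now apply Rmin_glb_lt|]; intros a b Hab t.
apply quo_dist_lt in Hab; [|apply Rmin_r]; destruct Hab as [Hc Hab].
specialize (H (pi a) (pi b) (Rlt_le_trans _ _ _ Hab (Rmin_l _ _))).
apply Rlt_le_trans with (2 := Rmin_l r delta), quo_dist_lt; [apply Rmin_r|].
split; [|rewrite !pi_act; apply H].
apply close_act; auto; intros s.
apply Rlt_le_trans with (1 := H s), Rmin_r.
Qed.

(** Proximal points have extensionally equal classes, from which [epsilon] picks the same point. *)
Lemma prox_class_representative : exists c : X -> X,
  (forall x, prox x (c x)) /\ (forall x y, prox x y -> c x = c y).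
Proof.
exists (fun x => epsilon (inhabits x) (prox x)); split.
- intros x; apply epsilon_spec; exists x; apply prox_refl.
- intros x y Hxy.
  assert (E : prox x = prox y).
  { apply functional_extensionality; intros z; apply propositional_extensionality.
    split; intros H; [apply prox_trans with x|apply prox_trans with y];
      auto using prox_sym. }
  now rewrite E, (proof_irrelevance _ (inhabits x) (inhabits y)).
Qed.

(** * Maximality of the equicontinuous factor *)

Hypothesis Huniv : forall (Z : Type) (dZ : Z -> Z -> R) (actZ : G -> Z -> Z)
    (rho : X -> Z),
  is_system opG zero add dZ actZ -> equicontinuous dZ actZ ->
  is_factor_map d act dZ actZ rho ->
  exists phi : Y -> Z, cont_map dY dZ phi /\ forall x, rho x = phi (pi x).

(** The chosen representatives with [quo_dist] form an equicontinuous factor whose fibres are the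
    proximality classes. By maximality [rho] factors through [pi]. *)
Lemma pi_eq_prox x y : pi x = pi y -> prox x y.
Proof.
destruct prox_class_representative as [c [Hc cE]].
assert (cc : forall x, c (c x) = c x) by (intros z; symmetry; apply cE, Hc).
set (Z := {z : X | c z = z}).
set (rho := fun x => exist _ (c x) (cc x) : Z).
set (dZ := fun a b : Z => quo_dist (proj1_sig a) (proj1_sig b)).
set (actZ := fun t (a : Z) => rho (act t (proj1_sig a))).
assert (Zeq : forall a b : Z, prox (proj1_sig a) (proj1_sig b) -> a = b).
{ intros [a Ha] [b Hb]; simpl; intros H; apply subset_eq_compat.
  rewrite <- Ha, <- Hb; auto. }
assert (rho_val : forall a : Z, rho (proj1_sig a) = a).
{ intros a; apply Zeq; simpl; apply prox_sym, Hc. }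
assert (rho_prox : forall a b, rho a = rho b <-> prox a b).
{ intros a b; split; intros H.
  - apply prox_trans with (c a); auto.
    apply (f_equal (@proj1_sig _ _)) in H; simpl in H; rewrite H.
    apply prox_sym, Hc.
  - apply Zeq; simpl; rewrite (cE _ _ H); apply prox_refl. }
assert (rho_act : forall t a, rho (act t a) = actZ t (rho a)).
{ intros t a; apply rho_prox, prox_act, Hc. }
assert (dZ_rho : forall a b, dZ (rho a) (rho b) = quo_dist a b).
{ intros a b; symmetry; apply quo_dist_prox; apply Hc. }
(* Surjectivity of [rho] as an induction principle: the axioms are checked on points [rho a]. *)
assert (Zind : forall P : Z -> Prop, (forall a, P (rho a)) -> forall z, P z).
{ intros P H z; rewrite <- rho_val; apply H. }
assert (rho_cont : cont_map d dZ rho).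
{ intros z r Hr; destruct (quo_dist_cont z r Hr) as [e [He H]].
  exists e; split; auto; intros z' Hz'; rewrite dZ_rho; auto. }
destruct (Huniv Z dZ actZ rho) as [phi [_ Hphi]].
- repeat split.
  + apply quo_dist_ge0.
  + intros H; apply Zeq, quo_dist_eq0; exact H.
  + intros ->; apply quo_dist_eq0, prox_refl.
  + apply quo_dist_sym.
  + apply quo_dist_tri.
  + intros J C Cop Ccov.
    destruct (proj2 (proj1 Hsys) J (fun j z => C j (rho z))) as [ls Hls].
    * intros j z Cz; destruct (Cop j _ Cz) as [r [Hr H]].
      destruct (rho_cont z r Hr) as [e [He H']]; exists e; auto.
    * intros z _; now apply Ccov.
    * exists ls; refine (Zind _ _); exact Hls.
  + refine (Zind _ _); intros a; now rewrite <- rho_act, act_zero.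
  + intros s t; refine (Zind _ _); intros a; now rewrite <- !rho_act, act_add.
  + intros t z r Hr; revert z; refine (Zind _ _); intros a.
    (* Joint continuity: continuity of the original action handles [act t a] against [act s a], and
       equicontinuity handles [act s a] against [act s b]. *)
    destruct (quo_dist_cont (act t a) (r / 2) ltac:(lra)) as [e1 [He1 H1]].
    destruct (quo_dist_equicont (r / 2) ltac:(lra)) as [e2 [He2 H2]].
    destruct (proj2 Hsys) as [_ Hcont].
    destruct (Hcont t a e1 He1) as [W [e3 [oW [Wt [He3 H3]]]]].
    exists W, e2; repeat split; auto; intros s z Ws; revert z; refine (Zind _ _); intros b Hb.
    rewrite <- !rho_act, dZ_rho; rewrite dZ_rho in Hb.
    specialize (H2 _ _ Hb s).
    assert (H4 := H1 _ (H3 s a Ws ltac:(rewrite (dist_xx _ _ Hd); lra))).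
    pose proof (quo_dist_tri (act t a) (act s a) (act s b)); lra.
- intros r Hr; destruct (quo_dist_equicont r Hr) as [e [He H]].
  exists e; split; auto.
  refine (Zind _ _); intros a; refine (Zind _ _); intros b Hab t.
  rewrite <- !rho_act, dZ_rho; rewrite dZ_rho in Hab; auto.
- repeat split; auto; intros z; exists (proj1_sig z); auto.
- intros H; apply rho_prox; now rewrite !Hphi, H.
Qed.

End Quotient.

End Factor.

End Proximality.

Theorem mainTheorem3
  (G : Type) (opG : (G -> Prop) -> Prop) (zero : G) (add : G -> G -> G) (opp : G -> G)
  (X : Type) (d : X -> X -> R) (act : G -> X -> X)
  (Xmax : Type) (dmax : Xmax -> Xmax -> R) (actmax : G -> Xmax -> Xmax)
  (pimax : X -> Xmax) :
  is_LCA_group opG zero add opp ->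
  compactly_generated opG zero add ->
  is_system opG zero add d act ->
  minimal_system d act ->
  is_max_eq_factor opG zero add d act dmax actmax pimax ->
  finite_minimal_rank pimax ->
  ((forall x y, Prox d act x y <-> RegProx d act x y) <-> closed2 d (Prox d act)).
Proof.
intros [_ [_ [HG _]]] [K [HK [[V [_ [V0 VK]]] Hgen]]] Hsys Hmin
  [HY [Heq [Hpi Huniv]]] [y0 [l Hl]].
destruct free_ultrafilter_exists as [U HU].
split; intros H.
(* If the two relations agree, closedness passes from the regional proximal relation to the proximal
   one. *)
- intros x y Hxy; apply H; apply (regprox_closed _ _ _ _ _ _ _ Hsys).
  intros dl Hdl; destruct (Hxy dl Hdl) as [x' [y' [H' ?]]].
  exists x', y'; split; [now apply H|auto].
- destruct (near_prox_gap U HU G opG zero add opp X d act HG Hsys Xmax dmax actmax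
    pimax HY Hpi H y0 l Hmin Hl K HK) as [eps [He gap]].
  destruct (near_dichotomy U HU G opG zero add X d act Hsys Xmax dmax actmax
    pimax HY Hpi eps He) as [delta [Hdl dich]].
  intros x y; split.
  + eapply prox_regprox; eauto.
  + intros Hxy; apply (regprox_pi U HU G opG zero add opp X d act HG Hsys
      Xmax dmax actmax pimax HY Heq Hpi) in Hxy; revert Hxy.
    eapply pi_eq_prox with (eps := eps) (delta := delta); eauto.
Qed.
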